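(* Let $(M,\tau,\ell,\mathfrak m)$ be a metric measure spacetime and $(f_n)$ a sequence of causal functions converging pointwise $\mathfrak m$-a.e. to a causal function $f$. Let $G_n$ be a weak subslope of $f_n$ for every $n$, and suppose that $(G_n)$ converges pointwise $\mathfrak m$-a.e. to a (Borel) function $G:M\to[0,+\infty]$. Then $G$ is a weak subslope of $f$.
   Context: Conventions in $\bar{\mathbb R}=[-\infty,+\infty]$: $+\infty-(+\infty)=+\infty$, $-\infty-(-\infty)=+\infty$, $\pm\infty+z=\pm\infty$ for every $z\in\bar{\mathbb R}$, $0\cdot(\pm\infty)=0$. A time separation on a set $M$ is a map $\ell:M\times M\to\{-\infty\}\cup[0,+\infty]$ with $\ell(x,x)=0$ and $\min\{\ell(x,y)+\ell(y,z),\ell(y,z)+\ell(x,y)\}\le\ell(x,z)$; write $x\le y$ if $\ell(x,y)\ge0$. A metric measure spacetime $(M,\tau,\ell,\mathfrak m)$: $\tau$ is a Polish topology, $\ell$ a time separation with $\le$ a partial order and $\{\ell\ge0\}$ closed in $M^2$, $\mathfrak m$ a non-zero non-negative Radon measure. $\gamma:[0,1]\to M$ is causal if $s\le t$ implies $\gamma_s\le\gamma_t$. Its causal speed $|\dot\gamma_t|\in[0,+\infty]$ is the density of the absolutely continuous part (w.r.t. Lebesgue measure) of the largest Borel measure $\nu$ on $[0,1]$ with $\nu((a,b))\le\ell(\gamma_a,\gamma_b)$ for all $0\le a<b\le1$; for a.e. $t$ it equals $\lim_{h\downarrow0}\ell(\gamma_t,\gamma_{t+h})/h$. $\mathrm{LCC}([0,1];M)$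 is the set of left-continuous causal curves with the topology of the distance $\mathsf D(\gamma,\eta)=\mathsf d(\gamma_0,\eta_0)+\int_0^1\mathsf d(\gamma_t,\eta_t)\,\mathrm dt$, $\mathsf d$ a bounded distance inducing $\tau$. $\mathsf e_t(\gamma):=\gamma_t$. A causal function is an $\mathfrak m$-measurable $f:M\to\bar{\mathbb R}$ such that $x\le y$ implies $f(x)\le f(y)$. A test plan is a Borel probability measure $\boldsymbol\pi$ on $\mathrm{LCC}([0,1];M)$ such that for some $C>0$, $(\mathsf e_t)_*\boldsymbol\pi\le C\mathfrak m$ for all $t\in[0,1]$. A Borel $G:M\to[0,+\infty]$ is a weak subslope of $f$ if $\int[f(\gamma_1)-f(\gamma_0)]\,\mathrm d\boldsymbol\pi(\gamma)\ge\iint_0^1G(\gamma_t)|\dot\gamma_t|\,\mathrm dt\,\mathrm d\boldsymbol\pi(\gamma)$ for every test plan $\boldsymbol\pi$. *)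

(* Defs.v *)
From HB Require Import structures.
From mathcomp Require Import all_boot all_order all_algebra.
From mathcomp Require Import all_classical all_reals all_analysis.
(* measurable_realfun, which declares the Borel sigma-algebra of \bar R, is not
   exported by all_analysis.  *)
From mathcomp Require Import measurable_realfun.

Set Implicit Arguments.
Unset Strict Implicit.
Unset Printing Implicit Defensive.

Import Order.TTheory GRing.Theory Num.Theory.
Import numFieldNormedType.Exports.

Local Open Scope classical_set_scope.
Local Open Scope ring_scope.
Local Open Scope ereal_scope.

(* The sum with (+oo) + z = +oo and (-oo) + z = -oo for every z: the left
   summand wins, so the operation is not commutative.  *)
Definition ladde (R : realType) (x y : \bar R) : \bar R :=
  match x with
  | r%:E => r%:E + y
  | +oo => +oo
  | -oo => -oo
  end.

(* The dual addition satisfies +oo + -oo = -oo + +oo = +oo, hence here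
   +oo - +oo = +oo, -oo - -oo = +oo, and +oo - z = +oo, -oo - z = -oo
   for the other values of z.  *)
Definition ediff (R : realType) (x y : \bar R) : \bar R := (x - y)%dE.

Record dist_inducing (R : realType) (T : topologicalType) (d : T -> T -> R) :
    Prop := DistInducing {
  dist_ge0 : forall x y, (0 <= d x y)%R ;
  dist_eq0 : forall x y, d x y = 0%R <-> x = y ;
  dist_sym : forall x y, d x y = d y x ;
  dist_triangle : forall x y z, (d x z <= d x y + d y z)%R ;
  dist_nbhs : forall x (A : set T),
    nbhs x A <-> exists2 e : R, (0 < e)%R & [set y | (d x y < e)%R] `<=` A
}.

Definition bounded_dist (R : realType) (T : Type) (d : T -> T -> R) : Prop :=
  exists B : R, forall x y, (d x y <= B)%R.

Definition complete_dist (R : realType) (T : topologicalType)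
    (d : T -> T -> R) : Prop :=
  forall u : nat -> T,
    (forall e : R, (0 < e)%R -> exists N : nat, forall m n : nat,
      (N <= m)%N -> (N <= n)%N -> (d (u m) (u n) < e)%R) ->
    exists x : T, u n @[n --> \oo] --> x.

Definition polish (R : realType) (T : topologicalType) : Prop :=
  (exists2 S : set T, countable S & dense S) /\
  (exists2 d : T -> T -> R, dist_inducing d & complete_dist d).

Notation borel T := (g_sigma_algebraType (@open T)).

Definition radon (R : realType) (T : ptopologicalType)
    (mu : {measure set (borel T) -> \bar R}) : Prop :=
  (forall x : T, exists U : set T, [/\ open U, U x & mu U < +oo]) /\
  (forall A : set (borel T), measurable A ->
    mu A = ereal_sup [set mu K | K in [set K : set T | compact K /\ K `<=` A]]).

Record time_separation (R : realType) (T : Type) (l : T -> T -> \bar R) :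
    Prop := TimeSeparation {
  tsep_range : forall x y, l x y = -oo \/ 0 <= l x y ;
  tsep_diag : forall x, l x x = 0 ;
  tsep_triangle : forall x y z,
    mine (ladde (l x y) (l y z)) (ladde (l y z) (l x y)) <= l x z
}.

Definition partial_order (T : Type) (r : T -> T -> Prop) : Prop :=
  [/\ forall x, r x x,
      forall x y, r x y -> r y x -> x = y
    & forall x y z, r x y -> r y z -> r x z].

(* The base point only says that the space is nonempty, which the reference
   measure being non-zero implies.  *)
Record mmspacetime (R : realType) := MMSpacetime {
  event :> ptopologicalType ;
  tsep : event -> event -> \bar R ;
  refmeas : {measure set (borel event) -> \bar R} ;
  mms_polish : polish R event ;
  mms_tsep : time_separation tsep ;
  mms_order : partial_order (fun x y => 0 <= tsep x y) ;
  mms_closed : closed [set p : event * event | 0 <= tsep p.1 p.2] ;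
  mms_radon : radon refmeas ;
  mms_neq0 : refmeas setT != 0
}.

Definition causal_le (R : realType) (M : mmspacetime R) (x y : M) : Prop :=
  0 <= tsep x y.

(* A curve on [0, 1] is encoded as its extension to R that is constant on
   ]-oo, 0] and on [1, +oo[; this is a bijection, and Leibniz equality
   of the encodings is equality of the curves on [0, 1].  *)
Record lcc (R : realType) (M : mmspacetime R) := LCC {
  curve :> R -> M ;
  curve_before : forall t : R, (t <= 0)%R -> curve t = curve 0%R ;
  curve_after : forall t : R, (1 <= t)%R -> curve t = curve 1%R ;
  curve_causal : forall s t : R, (0 <= s)%R -> (s <= t)%R -> (t <= 1)%R ->
    causal_le (curve s) (curve t) ;
  curve_lcont : forall t : R, (0 < t)%R -> (t <= 1)%R ->
    curve s @[s --> t^'-] --> curve t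
}.

Section lcc_pointed.
Context (R : realType) (M : mmspacetime R).

Lemma lcc_point_causal (s t : R) : (0 <= s)%R -> (s <= t)%R -> (t <= 1)%R ->
  @causal_le R M point point.
Proof. by move=> _ _ _; rewrite /causal_le (tsep_diag (mms_tsep M)). Qed.

Definition lcc_point : lcc M :=
  @LCC R M (cst point) (fun _ _ => erefl) (fun _ _ => erefl) lcc_point_causal
    (fun t _ _ => cvg_cst point).

HB.instance Definition _ := gen_eqMixin (lcc M).
HB.instance Definition _ := gen_choiceMixin (lcc M).
HB.instance Definition _ := isPointed.Build (lcc M) lcc_point.

End lcc_pointed.

Definition lcc_dist (R : realType) (M : mmspacetime R) (d : M -> M -> R)
    (g h : lcc M) : \bar R :=
  (d (g 0%R) (h 0%R))%:E +
  \int[lebesgue_measure]_(t in `[0%R, 1%R]) (d (g t) (h t))%:E.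

Definition lcc_open (R : realType) (M : mmspacetime R) (d : M -> M -> R) :
    set (set (lcc M)) :=
  [set U | forall g, U g -> exists2 e : R, (0 < e)%R &
    [set h | lcc_dist d g h < e%:E] `<=` U].

Notation borel_lcc d := (g_sigma_algebraType (lcc_open d)).

Section ac_part.
Context (R : realType).
Implicit Types nu mu sigma : {measure set (measurableTypeR R) -> \bar R}.

(* The absolutely continuous part of nu (w.r.t. Lebesgue measure) as the largest
   absolutely continuous measure below nu.  When nu has a Lebesgue
   decomposition this is its absolutely continuous term (lemma
   lebesgue_decomposition_ac_part); but the measures below need not be
   sigma-finite, and may then have no Lebesgue decomposition: if l = +oo along
   a curve, the largest measure gives mass +oo to every nonempty set, and
   its absolutely continuous part has density +oo.  *)
Definition is_ac_part nu mu : Prop :=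
  [/\ mu `<< lebesgue_measure,
      forall A, measurable A -> mu A <= nu A
    & forall mu', mu' `<< lebesgue_measure ->
        (forall A, measurable A -> mu' A <= nu A) ->
        forall A, measurable A -> mu' A <= mu A].

Lemma lebesgue_decomposition_ac_part nu mu sigma (N : set R) :
  mu `<< lebesgue_measure ->
  measurable N -> lebesgue_measure N = 0 -> sigma (~` N) = 0 ->
  (forall A, measurable A -> nu A = mu A + sigma A) ->
  is_ac_part nu mu.
Proof.
move=> mul mN N0 sN nuE; split=> [//|A mA|mu' mu'l mu'nu A mA].
  by rewrite nuE// leeDl.
have mAN : measurable (A `\` N) by exact: measurableD.
have mAIN : measurable (A `&` N) by exact: measurableI.
have mu'0 : mu' (A `&` N) = 0.
  apply: (iffLR (null_content_dominatesP mu' lebesgue_measure) mu'l _ mAIN).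
  by apply: (subset_measure0 mAIN mN _ N0) => x [].
have s0 : sigma (A `\` N) = 0.
  by apply: (subset_measure0 mAN (measurableC mN) _ sN) => x [].
have -> : mu' A = mu' (A `\` N).
  by rewrite -[RHS]adde0 -mu'0; exact: measureDI.
apply: (le_trans (mu'nu _ mAN)).
by rewrite nuE// s0 adde0 le_measure ?inE.
Qed.

End ac_part.

Section causal_speed.
Context (R : realType) (M : mmspacetime R).
Implicit Types (g : lcc M) (nu : {measure set (measurableTypeR R) -> \bar R}).

Definition speed_minorant g nu : Prop :=
  nu (~` `[0%R, 1%R]%classic) = 0 /\
  forall a b : R, (0 <= a)%R -> (a < b)%R -> (b <= 1)%R ->
    nu `]a, b[%classic <= tsep (g a) (g b).

Definition largest_speed_minorant g nu : Prop :=
  speed_minorant g nu /\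
  forall nu', speed_minorant g nu' -> forall A, measurable A -> nu' A <= nu A.

Definition is_causal_speed g (v : R -> \bar R) : Prop :=
  [/\ measurable_fun setT v, forall t, 0 <= v t &
      exists nu ac : {measure set (measurableTypeR R) -> \bar R},
        [/\ largest_speed_minorant g nu, is_ac_part nu ac &
            forall A : set (measurableTypeR R), measurable A -> A `<=` `[0%R, 1%R]%classic ->
              ac A = \int[lebesgue_measure]_(t in A) v t]].

(* A density exists for every curve, because l is superadditive along it, and is
   unique up to Lebesgue-null sets; only integrals of the speed matter below,
   so any version may be chosen.  *)
Definition causal_speed g : R -> \bar R :=
  xget (cst 0) [set v | is_causal_speed g v].

End causal_speed.

(* In the definition of a weak subslope the integrand on the left is only
   measurable for the completion of the plan, and measurability of the one on
   the right requires some measurability of l.  The upper integral is defined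
   in all cases, and is the usual integral whenever the function is
   measurable for the completion of the measure (lemma upper_integralE).  *)
Section upper_integral.
Context d (T : measurableType d) (R : realType).
Variable mu : {measure set T -> \bar R}.

Definition upper_integral (F : T -> \bar R) : \bar R :=
  ereal_inf [set \int[mu]_x H x | H in
    [set H : T -> \bar R | [/\ measurable_fun setT H, forall x, 0 <= H x
                             & forall x, F x <= H x]]].

Lemma upper_integralE (F H : T -> \bar R) :
  measurable_fun setT H -> (forall x, 0 <= H x) ->
  {ae mu, forall x, F x = H x} ->
  upper_integral F = \int[mu]_x H x.
Proof.
move=> mH H0 [N [mN N0 FHN]]; apply/eqP; rewrite eq_le; apply/andP; split.
  pose H' := (fun x => if x \in N then +oo else H x) : T -> \bar R.
  have mH' : measurable_fun setT H'.
    apply: measurable_fun_ifT => //.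
    by apply: (measurable_fun_bool true); rewrite setTI preimage_mem_true.
  have H'0 x : 0 <= H' x by rewrite /H'; case: ifP.
  have <- : \int[mu]_x H' x = \int[mu]_x H x.
    apply: ge0_ae_eq_integral => //; exists N; split=> // x /=.
    apply: contra_notP => xN _; rewrite /H' ifF//.
    by apply/negbTE/negP => /set_mem.
  apply: ereal_inf_lbound; exists H' => //; split=> // x.
  rewrite /H'; case: ifPn => [_|xN]; first exact: leey.
  suff -> : F x = H x by [].
  by apply: contrapT => FH; move/negP : xN; apply; apply/mem_set/FHN.
apply: le_ereal_inf_tmp => _ [K [mK K0 FK] <-].
apply: ae_ge0_le_integral => //; exists N; split=> // x /= xHK.
by apply: FHN => /= FH; apply: xHK => _; rewrite -FH.
Qed.

End upper_integral.

Definition causal_function (R : realType) (M : mmspacetime R)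
    (f : M -> \bar R) : Prop :=
  (forall Y : set (\bar R), measurable Y ->
    completed_algebra_gen (@refmeas R M) (f @^-1` Y)) /\
  (forall x y : M, causal_le x y -> f x <= f y).

Section weak_subslope.
Context (R : realType) (M : mmspacetime R) (d : M -> M -> R).

Definition test_plan (pi : probability (borel_lcc d) R) : Prop :=
  exists2 C : R, (0 < C)%R & forall t : R, (0 <= t)%R -> (t <= 1)%R ->
    forall A : set (borel M), measurable A ->
      pi [set g : lcc M | A (g t)] <= C%:E * refmeas M A.

Definition weak_subslope (f G : M -> \bar R) : Prop :=
  [/\ measurable_fun setT (G : borel M -> \bar R), forall x, 0 <= G x &
      forall pi : probability (borel_lcc d) R, test_plan pi ->
        upper_integral pi (fun g : lcc M =>
          \int[lebesgue_measure]_(t in `[0%R, 1%R]) (G (g t) * causal_speed g t))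
        <= upper_integral pi (fun g : lcc M => ediff (f (g 1%R)) (f (g 0%R)))].

End weak_subslope.

(* Main.v *)
(**
Fix a test plan [pi] and a measurable majorant [H] of [f (g 1) - f (g 0)]. For
[e > 0], let [D n] be the set of curves with [f_n (g 1) - f_n (g 0) <= H g + e];
[pi]-almost every curve lies in [D n] for all large [n]. The normalised
restriction of [pi] to [D n] is a test plan, so [G_n] being a subslope of [f_n]
yields a majorant [K n] of [g |-> \int G_n (g t) |g'_t| dt] whose integral over
[D n] is at most that of [H + e], up to [e]. By Fatou's lemma in [t], the lower
limit of the [K n] restricted to [D n] dominates
[\int G (g t) |g'_t| dt] almost surely, and by Fatou's lemma in [g] its integral
is at most [\int H dpi + 2 e].

Two facts make this rigorous: evaluation [(t, g) |-> g t] is jointly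
measurable, so that by Fubini's theorem almost every curve avoids a given null
set at almost every time; and each [f_n] is almost everywhere equal to a Borel
function, so that [D n] can be taken measurable.
*)

Require Import Defs.
From mathcomp Require Import all_boot all_order all_algebra.
From mathcomp Require Import all_classical all_reals all_analysis.
From mathcomp Require Import measurable_realfun.
From mathcomp Require Import lra.

Import Order.TTheory GRing.Theory Num.Theory.
Import numFieldNormedType.Exports.

Local Open Scope classical_set_scope.
Local Open Scope ring_scope.
Local Open Scope ereal_scope.

(** * Measurability of left-continuous functions *)

Section left_continuous.
Context {R : realType}.

(* The largest multiple of [1 / (n + 1)] that is strictly less than [t]. *)
Definition lgrid (n : nat) (t : R) : R :=
  ((Num.ceil (t * n.+1%:R) - 1)%:~R / n.+1%:R)%R.

Lemma lgrid_lt n t : (lgrid n t < t)%R.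
Proof. by rewrite /lgrid ltr_pdivrMr// ceilB1_lt. Qed.

Lemma lgrid_ge n t : (t - n.+1%:R^-1 <= lgrid n t)%R.
Proof.
rewrite /lgrid ler_pdivlMr// mulrBl mulVf// intrD lerB//.
exact: ceil_ge.
Qed.

Lemma cvg_lgrid (T : topologicalType) (h : R -> T) (t : R) :
  h s @[s --> t^'-] --> h t -> h (lgrid n t) @[n --> \oo] --> h t.
Proof.
apply: cvg_comp => A [e /= e0 eA].
have := near_infty_natSinv_lt (PosNum e0); apply: filterS => n /= ne.
apply: eA (lgrid_lt n t); rewrite /ball_/= ger0_norm ?subr_ge0 ?ltW ?lgrid_lt//.
by rewrite (le_lt_trans _ ne)// lerBlDr addrC -lerBlDr lgrid_ge.
Qed.

(** [lgrid n] takes countably many values, each on a half-open interval, so the preimage is a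
    countable union of rectangles. *)
Lemma measurable_fun_lgrid d d' (T : measurableType d) (U : measurableType d')
    (Phi : R -> T -> U) (n : nat) :
  (forall t, measurable_fun setT (Phi t)) ->
  measurable_fun setT (fun p : R * T => Phi (lgrid n p.1) p.2).
Proof.
move=> mPhi _ Y mY; rewrite setTI.
rewrite (_ : _ @^-1` _ = \bigcup_(z : int)
   (`]((z - 1)%:~R / n.+1%:R)%R, (z%:~R / n.+1%:R)%R]%classic `*`
    (Phi ((z - 1)%:~R / n.+1%:R)%R @^-1` Y))).
  apply: countable_bigcupT_measurable; first exact: countableP.
  move=> z; apply: measurableX; first exact: measurable_itv.
  by rewrite -[X in measurable X]setTI; exact: mPhi.
apply/seteqP; split=> [[t x] /= Ytx|[t x] [z _ [/=]]].
  exists (Num.ceil (t * n.+1%:R)) => //; split => //=.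
  by rewrite in_itv/= ltr_pdivrMr// ler_pdivlMr// ceil_itv.
rewrite in_itv/= ltr_pdivrMr// ler_pdivlMr// -ceil_eq => /eqP <-.
by [].
Qed.

(** Freezing the time at the grid points before [t] gives jointly measurable functions, which
    converge pointwise by left continuity. *)
Lemma measurable_fun_left_continuous d (T : measurableType d) (Phi : R -> T -> R) :
  (forall t, measurable_fun setT (Phi t)) ->
  (forall t x, Phi s x @[s --> t^'-] --> Phi t x) ->
  measurable_fun setT (fun p : R * T => Phi p.1 p.2).
Proof.
move=> mPhi lPhi; apply: (@measurable_fun_cvg _ _ _ _
  (fun n p => Phi (lgrid n p.1) p.2)) => [n|[t x] _ /=].
  exact: measurable_fun_lgrid.
by apply: (@cvg_lgrid _ (Phi ^~ x)); exact: lPhi.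
Qed.

Lemma left_continuous_measurable_fun (h : R -> R) :
  (forall t, h s @[s --> t^'-] --> h t) -> measurable_fun setT h.
Proof.
move=> lh; have := @measurable_fun_left_continuous _ R (fun t _ => h t).
move=> /(_ (fun=> measurable_cst _) (fun t _ => lh t)) mh.
exact: (measurableT_comp mh
  (measurable_fun_pair (@measurable_id _ R setT) (@measurable_id _ R setT))).
Qed.

End left_continuous.

(** * Distances along curves *)

Section evaluation.
Context {R : realType} {M : mmspacetime R} {d : M -> M -> R}.
Hypothesis d_inducing : dist_inducing d.
Implicit Types (g h : lcc M) (p x y : M) (t : R).

(** The constant extension makes a curve left-continuous on all of [R], including at [0] and beyond
    [1]. *)
Lemma curve_left_cvg g t : g s @[s --> t^'-] --> g t.
Proof.
have [t0|t0] := leP t 0%R.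
  rewrite (curve_before g t0); apply: cvg_near_cst.
  apply: filterS (nbhs_left_le t) => s st.
  by rewrite curve_before// (le_trans st).
have [t1|t1] := leP t 1%R; first exact: curve_lcont.
rewrite (curve_after g (ltW t1)); apply: cvg_near_cst.
by apply: filterS (nbhs_left_ge t1) => s st; rewrite curve_after.
Qed.

Lemma near_dist x (e : R) : (0 < e)%R -> \forall y \near x, (d x y < e)%R.
Proof. by move=> e0; apply/(dist_nbhs d_inducing); exists e. Qed.

Lemma dist_self x : d x x = 0%R.
Proof. exact/(dist_eq0 d_inducing). Qed.

Lemma ler_dist_dist x y x' y' : (`|d x y - d x' y'| <= d x x' + d y y')%R.
Proof.
have := dist_triangle d_inducing x x' y.
have := dist_triangle d_inducing x' y' y.
have := dist_triangle d_inducing x' x y'.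
have := dist_triangle d_inducing x y y'.
rewrite (dist_sym d_inducing x' x) (dist_sym d_inducing y' y) ler_norml.
by lra.
Qed.

Lemma curve_dist_left_cvg g h t :
  d (g s) (h s) @[s --> t^'-] --> d (g t) (h t).
Proof.
apply/cvgrPdist_lt => e e0; have e20 : (0 < e / 2)%R by rewrite divr_gt0.
have := curve_left_cvg g t _ (near_dist (g t) _ e20).
have := curve_left_cvg h t _ (near_dist (h t) _ e20).
rewrite !near_simpl; apply: filterS2 => s /= dh dg.
by rewrite (le_lt_trans (ler_dist_dist _ _ _ _))// [ltRHS](splitr e) ltrD.
Qed.

(* The constant curve at [p], so that distances to a point are distances
   between curves. *)
Definition cst_curve p : lcc M :=
  @LCC R M (cst p) (fun _ _ => erefl) (fun _ _ => erefl)
    (fun _ _ _ _ _ => eq_ind_r (fun z => 0 <= z) (lexx 0) (tsep_diag (mms_tsep M) p))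
    (fun t _ _ => cvg_cst p).

Lemma measurable_curve_dist g h : measurable_fun setT (fun t => d (g t) (h t)).
Proof.
by apply: left_continuous_measurable_fun => t; exact: curve_dist_left_cvg.
Qed.

(** By the triangle inequality the integral grows by at most [lcc_dist d g h] from [g] to [h], so
    its strict sublevel sets belong to [lcc_open d]. *)
Lemma measurable_integral_dist p (A : set R) : measurable A ->
  A `<=` `[0%R, 1%R]%classic ->
  measurable_fun setT (fun g : borel_lcc d =>
    \int[lebesgue_measure]_(t in A) (d p ((g : lcc M) t))%:E).
Proof.
move=> mA A01; apply: (measurability _ (ErealGenInftyO.measurableE R)) => //.
move=> _ [_ [r ->] <-]; rewrite setTI; apply: sub_sigma_algebra => /= g.
rewrite /= in_itv/= => gr.
have md (x y : lcc M) : measurable_fun A (fun t => (d (x t) (y t))%:E).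
  apply/measurable_EFinP.
  exact: measurable_funS measurableT (@subsetT _ _) (measurable_curve_dist x y).
have g0 : 0 <= \int[lebesgue_measure]_(t in A) (d p (g t))%:E.
  by apply: integral_ge0 => t _; rewrite lee_fin (dist_ge0 d_inducing).
have gfin : \int[lebesgue_measure]_(t in A) (d p (g t))%:E \is a fin_num.
  by rewrite ge0_fin_numE// (lt_trans gr) ?ltry.
exists (r - fine (\int[lebesgue_measure]_(t in A) (d p (g t))%:E))%R.
  by rewrite subr_gt0 -lte_fin fineK.
move=> h; rewrite /= in_itv/= EFinB fineK// lteBrDl//; apply: le_lt_trans.
apply: (@le_trans _ _ (\int[lebesgue_measure]_(t in A)
    ((d p (g t))%:E + (d (g t) (h t))%:E))).
  apply: ge0_le_integral => //.
  - by move=> t _; rewrite lee_fin (dist_ge0 d_inducing).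
  - exact: (md (cst_curve p)).
  - by apply: emeasurable_funD; [exact: (md (cst_curve p))|exact: md].
  - by move=> t _; rewrite -EFinD lee_fin (dist_triangle d_inducing).
rewrite ge0_integralD//; last 4 first.
- by move=> t _; rewrite lee_fin (dist_ge0 d_inducing).
- exact: (md (cst_curve p)).
- by move=> t _; rewrite lee_fin (dist_ge0 d_inducing).
- exact: md.
rewrite leeD2l// /lcc_dist.
apply: (@le_trans _ _ (\int[lebesgue_measure]_(t in `[0%R, 1%R]) (d (g t) (h t))%:E)).
  apply: ge0_subset_integral => //.
  - apply/measurable_EFinP.
    exact: measurable_funS measurableT (@subsetT _ _) (measurable_curve_dist g h).
  - by move=> t _; rewrite lee_fin (dist_ge0 d_inducing).
by rewrite leeDr// lee_fin (dist_ge0 d_inducing).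
Qed.

Lemma measurable_initial_dist p :
  measurable_fun setT (fun g : borel_lcc d => d p ((g : lcc M) 0%R)).
Proof.
apply: (measurability _ (RGenInftyO.measurableE R)) => //.
move=> _ [_ [r ->] <-]; rewrite setTI; apply: sub_sigma_algebra => /= g.
rewrite /= in_itv/= => gr.
exists (r - d p (g 0%R))%R; first by rewrite subr_gt0.
move=> h; rewrite /= in_itv/= EFinB => /(le_lt_trans _) gh.
have {gh} := gh (d (g 0%R) (h 0%R))%:E; rewrite /lcc_dist leeDl; last first.
  by apply: integral_ge0 => t _; rewrite lee_fin (dist_ge0 d_inducing).
rewrite -EFinB lte_fin => /(_ isT).
by have := dist_triangle d_inducing p (g 0%R) (h 0%R); lra.
Qed.

(** Left continuity keeps [f] within [e] of [f t] on short intervals ending at [t]. Such averages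
    recover the value at a time from integrals, which [lcc_dist] controls. *)
Lemma left_average_cvg (f : R -> R) t (u : nat -> R) :
  measurable_fun setT f -> (forall s, 0 <= f s)%R ->
  f s @[s --> t^'-] --> f t ->
  (forall n, 0 < u n)%R -> u n @[n --> \oo] --> 0%R ->
  (u n)^-1%:E * \int[lebesgue_measure]_(s in `](t - u n)%R, t]) (f s)%:E
    @[n --> \oo] --> (f t)%:E.
Proof.
move=> mf f0 ft u0 uc.
set I := fun n => \int[lebesgue_measure]_(s in `](t - u n)%R, t]) (f s)%:E.
have I0 n : 0 <= I n by apply: integral_ge0 => s _; rewrite lee_fin.
have mf' (A : set R) : measurable_fun A (fun s => (f s)%:E).
  apply/measurable_EFinP.
  exact: measurable_funS measurableT (@subsetT _ _) mf.
have lenE n : lebesgue_measure `](t - u n)%R, t]%classic = (u n)%:E.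
  rewrite lebesgue_measure_itv/= lte_fin ltrBlDr ltrDl u0 -EFinB; congr EFin.
  by rewrite opprB addrC subrK.
(* Both bounds are multiplied by the length [u n] and avoid subtraction, so they make sense before
   [I n] is known to be finite; the second one yields finiteness. *)
have close (e : R) : (0 < e)%R ->
    \forall n \near \oo, (f t)%:E * (u n)%:E <= I n + e%:E * (u n)%:E /\
      I n <= (f t + e)%:E * (u n)%:E.
  move=> e0; move/cvgrPdist_lt : (ft) => /(_ e e0)[a /= a0 fta].
  move/cvgrPdist_lt : (uc) => /(_ a a0); apply: filterS => n.
  rewrite sub0r normrN gtr0_norm// => una.
  have fe s : `](t - u n)%R, t]%classic s -> (`|f t - f s| < e)%R.
    rewrite /= in_itv/= => /andP[us]; rewrite le_eqVlt => /predU1P[->|st].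
      by rewrite subrr normr0.
    apply: fta => //=; rewrite ger0_norm ?subr_ge0 ?ltW//.
    by rewrite ltrBlDr -ltrBlDl (lt_trans _ us)// ltrD2l ltrN2.
  split.
    have -> : I n + e%:E * (u n)%:E =
        \int[lebesgue_measure]_(s in `](t - u n)%R, t]) ((f s)%:E + cst e%:E s).
      rewrite -lenE -integral_cst// ge0_integralD//.
      - by move=> s _; rewrite lee_fin.
      - exact: mf'.
      - by move=> s _; rewrite /= lee_fin ltW.
    rewrite -lenE -integral_cst//; apply: ge0_le_integral => //.
    - by move=> s _; rewrite /= lee_fin.
    - by apply: emeasurable_funD => //; exact: mf'.
    - move=> s /fe; rewrite ltr_norml /cst -EFinD lee_fin => /andP[_].
      by rewrite ltrBlDr addrC => /ltW.
  rewrite -lenE -!integral_cst//.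
  apply: ge0_le_integral => //.
  - by move=> s _; rewrite lee_fin.
  - exact: mf'.
  - move=> s /fe; rewrite ltr_norml /cst lee_fin => /andP[+ _].
    by rewrite ltrNl opprB ltrBlDl => /ltW.
apply/fine_cvgP; split.
  apply: filterS (close 1%R ltr01) => n [_ In].
  apply: fin_numM => //; rewrite -/(I n) ge0_fin_numE//.
  by apply: (le_lt_trans In); rewrite -EFinM ltry.
apply/cvgrPdist_le => e e0; apply: filterS (close e e0) => n [] /=.
rewrite -/(I n); case: (I n) (I0 n) => [r r0| |]//=.
rewrite -!EFinM -EFinD !lee_fin => tr rt; rewrite ler_norml.
have un0 := u0 n.
have -> : ((u n)^-1 * r = r / u n)%R by rewrite mulrC.
apply/andP; split.
  by rewrite lerNl opprB lerBlDl ler_pdivrMr.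
by rewrite lerBlDr -lerBlDl ler_pdivlMr// mulrBl lerBlDr.
Qed.

(** At time [0] the distance is a summand of [lcc_dist]; at times in []0, 1]] it is a limit of
    averages; any other time reduces to an endpoint. *)
Lemma measurable_eval_dist p t :
  measurable_fun setT (fun g : borel_lcc d => d p ((g : lcc M) t)).
Proof.
wlog : t / (0 <= t <= 1)%R => [wlg|/andP[]].
  have [t0|t0] := leP t 0%R.
    under eq_fun do rewrite curve_before//; exact: measurable_initial_dist.
  have [t1|/ltW t1] := leP t 1%R; first by apply: wlg; rewrite ltW.
  by under eq_fun do rewrite curve_after//; apply: wlg; rewrite ler01 lexx.
rewrite le_eqVlt => /predU1P[<- _|t0 t1]; first exact: measurable_initial_dist.
(* A width of at most [t] keeps the averaging intervals inside [[0, 1]]. *)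
apply/measurable_EFinP; pose u n := (t / n.+1%:R)%R.
apply: (@emeasurable_fun_cvg _ _ _ _ (fun n (g : borel_lcc d) =>
  (u n)^-1%:E * \int[lebesgue_measure]_(s in `](t - u n)%R, t])
    (d p ((g : lcc M) s))%:E)).
  move=> n; apply: measurable_funeM; apply: measurable_integral_dist => //.
  move=> s /=; rewrite !in_itv/= => /andP[/ltW us st]; rewrite (le_trans st)// andbT.
  by rewrite (le_trans _ us)// subr_ge0 ler_pdivrMr// ler_peMr ?ler1n// ltW.
move=> g _; apply: (@left_average_cvg (fun s => d p (g s))).
- exact: (measurable_curve_dist (cst_curve p)).
- by move=> s; rewrite (dist_ge0 d_inducing).
- exact: (curve_dist_left_cvg (cst_curve p)).
- by move=> n; rewrite divr_gt0.
- by rewrite -[X in _ --> X](mulr0 t); apply: cvgMl_tmp; exact: cvg_harmonic.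
Qed.

End evaluation.

(** * Borel measurability of evaluation, and null sets under test plans *)

Section borel_evaluation.
Context {R : realType} {M : mmspacetime R} {d : M -> M -> R}.
Hypothesis d_inducing : dist_inducing d.

Lemma open_ball_dist (x : M) (e : R) : open [set y | (d x y < e)%R].
Proof.
rewrite openE => y /= xye; apply/(dist_nbhs d_inducing).
exists (e - d x y)%R; first by rewrite subr_gt0.
by move=> z /=; have := dist_triangle d_inducing x y z; lra.
Qed.

Lemma dense_sequence : exists e : nat -> M, dense (range e).
Proof.
have [[S Scount Sdense] _] := mms_polish M.
have [x Sx] : S !=set0.
  have [|x [_ Sx]] := Sdense setT _ openT; first by exists point.
  by exists x.
move: Scount => /countable_injP[f finj].
exists (fun k => xget x [set y | S y /\ f y = k]).
move=> U U0 oU; have [y [Uy Sy]] := Sdense U U0 oU; exists y; split=> //.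
exists (f y) => //; case: xgetP => [z _ [Sz]|/(_ y)]; last by case.
by apply: finj; apply/mem_set.
Qed.

Lemma open_countable_balls (e : nat -> M) (U : set M) : dense (range e) -> open U ->
  U = \bigcup_(p in [set p : nat * nat |
        [set y | (d (e p.1) y < p.2.+1%:R^-1)%R] `<=` U])
      [set y | (d (e p.1) y < p.2.+1%:R^-1)%R].
Proof.
move=> edense Uopen; apply/seteqP; split; last by move=> y [p pU] /pU.
move=> x Ux.
have /(dist_nbhs d_inducing)[r /= r0 xrU] : nbhs x U by exact: open_nbhs_nbhs.
(* With this radius, a ball centred at a point of the dense sequence and containing [x] has all its
   points within [r] of [x]. *)
have [n /= nr] : exists n, (n.+1%:R^-1 < r / 2)%R.
  have r20 : (0 < r / 2)%R by rewrite divr_gt0.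
  have [N _ /(_ N (leqnn N)) Nr] := near_infty_natSinv_lt (PosNum r20).
  by exists N.
have [|y0 [/= xk [k _ ky0]]] := edense _ _ (open_ball_dist x n.+1%:R^-1).
  by exists x; rewrite /= (dist_self d_inducing) invr_gt0.
rewrite -{y0}ky0 in xk; exists (k, n) => /=; last by rewrite (dist_sym d_inducing).
move=> y /= ky; apply: xrU => /=.
move: ky nr xk; have := dist_triangle d_inducing x (e k) y; set z := (_ ^-1)%R; lra.
Qed.

(** By separability, every open set is a countable union of balls, and preimages of balls are
    sublevel sets of distances to points. *)
Lemma measurable_fun_borel d' (T : measurableType d') (u : T -> M) :
  (forall p, measurable_fun setT (fun x => d p (u x))) ->
  measurable_fun setT (u : T -> borel M).
Proof.
move=> mu; have [e edense] := dense_sequence.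
apply: (@measurability _ _ T (borel M) setT u (@open M)) => // _ [U Uopen <-].
rewrite setTI (open_countable_balls _ _ edense Uopen) preimage_bigcup bigcup_mkcond.
apply: countable_bigcupT_measurable; first exact: countableP.
move=> p; case: ifP => // _.
rewrite (_ : _ @^-1` _ =
  (fun x => d (e p.1) (u x)) @^-1` `]-oo, (p.2.+1%:R^-1)%R[%classic).
  by rewrite -[X in measurable X]setTI; apply: mu.
by apply/seteqP; split=> x /=; rewrite in_itv.
Qed.

Lemma measurable_eval (t : R) :
  measurable_fun setT (fun g : borel_lcc d => (g : lcc M) t : borel M).
Proof. by apply: measurable_fun_borel => p; exact: measurable_eval_dist. Qed.

Lemma measurable_joint_eval :
  measurable_fun setT
    (fun p : measurableTypeR R * borel_lcc d => (p.2 : lcc M) p.1 : borel M).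
Proof.
apply: measurable_fun_borel => p.
have := @measurable_fun_left_continuous R _ (borel_lcc d)
  (fun t g => d p ((g : lcc M) t)); apply.
  by move=> t; exact: measurable_eval_dist.
by move=> t g; exact: (curve_dist_left_cvg d_inducing (cst_curve p)).
Qed.

Lemma measurable_curve (g : lcc M) :
  measurable_fun setT (fun t : measurableTypeR R => g t : borel M).
Proof.
apply: measurable_fun_borel => p.
exact: (measurable_curve_dist d_inducing (cst_curve p)).
Qed.

Lemma test_plan_null (pi : probability (borel_lcc d) R) (N : set (borel M)) t :
  test_plan pi -> measurable N -> refmeas M N = 0 ->
  pi [set g : borel_lcc d | N ((g : lcc M) t)] = 0.
Proof.
move=> [C C0 piC] mN N0.
wlog : t / (0 <= t <= 1)%R => [wlg|/andP[t0 t1]].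
  have [t0|t0] := leP t 0%R.
    under eq_set do rewrite curve_before//.
    by apply: wlg; rewrite lexx ler01.
  have [t1|/ltW t1] := leP t 1%R; first by apply: wlg; rewrite ltW.
  under eq_set do rewrite curve_after//.
  by apply: wlg; rewrite ler01 lexx.
apply/eqP; rewrite eq_le measure_ge0 andbT.
by have := piC t t0 t1 N mN; rewrite N0 mule0.
Qed.

(** Tonelli's theorem for the set [E] of pairs [(t, g)] with [g t] in [N]: its sections at fixed [t]
    are [pi]-null, hence almost all its sections at fixed [g] are Lebesgue-null. *)
Lemma test_plan_ae_null (pi : probability (borel_lcc d) R) (N : set (borel M)) :
  test_plan pi -> measurable N -> refmeas M N = 0 ->
  {ae pi, forall g : borel_lcc d,
    {ae (@lebesgue_measure R), forall t, ~ N ((g : lcc M) t)}}.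
Proof.
move=> plan mN N0.
pose E := [set p : measurableTypeR R * borel_lcc d | N ((p.2 : lcc M) p.1)].
have mE : measurable E.
  by rewrite -[E]setTI; exact: measurable_joint_eval.
have := @indic_fubini_tonelli _ _ _ _ R (@lebesgue_measure R) pi E mE.
rewrite indic_fubini_tonelli_FE// indic_fubini_tonelli_GE//.
rewrite (_ : \int[_]_x _ = 0); last first.
  apply: integral0_eq => t _ /=; rewrite -[RHS](test_plan_null _ _ t plan mN N0).
  by congr (pi _); apply/seteqP; split=> g; rewrite /= /xsection/= inE.
move=> /esym I0.
have mG := measurable_fun_ysection (@lebesgue_measure R) mE.
have /(ae_eq_integral_abs pi measurableT mG)[A [mA A0 EA]] :
    \int[pi]_(g in setT) `|((@lebesgue_measure R) \o ysection E) g| = 0.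
  by rewrite -[RHS]I0; apply: eq_integral => g _; rewrite gee0_abs.
exists A; split=> // g gN; apply: EA => /= g0; apply: gN.
exists (ysection E g); split; [exact: measurable_ysection|exact: g0|].
by move=> t /=; rewrite notK => Nt; rewrite /ysection/= inE.
Qed.

End borel_evaluation.

(** * Measurable modifications and limits of extended real functions *)

(** The superlevel sets at rational levels determine [f]. Each is measurable up to a null set, and
    the countably many null sets are discarded together. *)
Lemma completed_measurable_modification d (T : measurableType d) (R : realType)
    (mu : {measure set T -> \bar R}) (f : T -> \bar R) :
  (forall Y : set (\bar R), measurable Y -> completed_algebra_gen mu (f @^-1` Y)) ->
  exists2 f' : T -> \bar R, measurable_fun setT f' & {ae mu, forall x, f' x = f x}.
Proof.
(* [q] enumerates the rationals, with value [0] at integers that encode none. *)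
move=> mf; pose q n : R := ratr (odflt 0%R (unpickle n : option rat)).
have /choice[A /choice[B AB]] : forall n, exists A B : set T,
    [/\ measurable A, measurable B, mu B = 0 &
        forall x, ~ B x -> (A x <-> (q n)%:E < f x)].
  move=> n; have [A mA [N [B [mB B0 NB]]] AN] :=
    mf _ (emeasurable_itv `](q n)%:E, +oo[).
  exists A, B; split=> // x Bx; have : (A `|` N) x <-> (q n)%:E < f x.
    by rewrite AN/= in_itv/= andbT.
  move=> <-; split=> [|[//|/NB//]]; by left.
have mB : measurable (\bigcup_n B n).
  by apply: bigcupT_measurable => n; have [] := AB n.
have nB : mu.-negligible (\bigcup_n B n).
  apply: negligible_bigcup => n; have [_ mBn Bn0 _] := AB n.
  by exists (B n); split.
have mf' : measurable_fun (~` \bigcup_n B n) f.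
  apply: (measurability _ (ErealGenOInfty.measurableE R)) => _ [_ [r ->] <-].
  rewrite (_ : _ `&` _ = \bigcup_(n in [set n | (r <= q n)%R])
      (A n `&` ~` \bigcup_n B n)).
    apply: bigcup_measurable => n _; have [mAn _ _ _] := AB n.
    by apply: measurableI => //; exact: measurableC.
  apply/seteqP; split=> [x [Bx]|x [n /= rq [Anx Bx]]].
    rewrite /= in_itv/= andbT => rfx.
    have [n rqn qnf] : exists2 n, (r <= q n)%R & (q n)%:E < f x.
      have [s rs sf] : exists2 s : R, (r < s)%R & s%:E < f x.
        case: (f x) rfx => [s rs| _|//].
          by exists ((r + s) / 2)%R; rewrite ?lte_fin; rewrite lte_fin in rs; lra.
        by exists (r + 1)%R; rewrite ?ltrDl// ltry.
      have [p] := rat_in_itvoo rs; rewrite in_itv/= => /andP[rp ps].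
      exists (pickle p); rewrite /q pickleK/=; first exact: ltW.
      by apply: le_lt_trans sf; rewrite lee_fin ltW.
    exists n => //; split=> //; have [_ _ _ AnE] := AB n.
    by apply/(AnE x) => // Bnx; apply: Bx; exists n.
  split=> //; rewrite /= in_itv/= andbT; have [_ _ _ AnE] := AB n.
  have Bnx : ~ B n x by move=> Bnx; apply: Bx; exists n.
  by apply: le_lt_trans ((AnE x Bnx).1 Anx); rewrite lee_fin.
exists (f \_ (~` \bigcup_n B n)).
  by apply/(measurable_restrictT _ _).1 => //; exact: measurableC.
apply: negligibleS nB => x /= fx; apply: contrapT => Bx; apply: fx.
by rewrite patchE ifT//; apply/mem_set.
Qed.

Lemma le_limn_einf (R : realType) (u v : nat -> \bar R) :
  (\forall n \near \oo, u n <= v n) -> limn_einf u <= limn_einf v.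
Proof.
move=> [N _ uv]; rewrite !limn_einf_lim.
apply: lee_lim; [exact: is_cvg_einfs..|].
exists N => // n /= Nn; apply: le_ereal_inf_tmp => _ [m /= nm <-].
apply: le_trans (uv m (leq_trans Nn nm)).
by apply: ereal_inf_lbound; exists m.
Qed.

Lemma limn_einf_le_cst (R : realType) (u : nat -> \bar R) (c : \bar R) :
  (forall n, u n <= c) -> limn_einf u <= c.
Proof.
move=> uc; rewrite -[leRHS](cvg_limn_einf_sup (cvg_cst c)).1.
by apply: le_limn_einf; exact: nearW.
Qed.

(** In the ordinary sum, opposite infinities give [-oo], whose opposite is the value [+oo]
    prescribed for [ediff]. Results on ordinary differences thus become available. *)
Lemma ediffE (R : realType) (x y : \bar R) : ediff x y = - (y - x).
Proof. by case: x y => [x||] [y||] //=; rewrite /ediff /= ?opprB. Qed.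

Lemma measurable_fun_limn_einf d (T : measurableType d) (R : realType) (D : set T)
    (f : nat -> T -> \bar R) :
  (forall n, measurable_fun D (f n)) -> measurable_fun D (fun x => limn_einf (f ^~ x)).
Proof.
move=> mf; apply: (emeasurable_fun_cvg (fun n x => einfs (f ^~ x) n)).
  exact: measurable_fun_einfs.
by move=> x _; rewrite limn_einf_lim; exact: is_cvg_einfs.
Qed.

(* Where [ediff] is not continuous, its value is [+oo]. *)
Lemma near_ediff_le (R : realType) (u v : nat -> \bar R) (a b h : \bar R) (e : R) :
  u n @[n --> \oo] --> a -> v n @[n --> \oo] --> b ->
  (0 < e)%R -> 0 <= h -> ediff a b <= h ->
  \forall n \near \oo, ediff (u n) (v n) <= h + e%:E.
Proof.
move=> ua vb e0; case: h => [h||] //; last by move=> _ _; apply: nearW => n; rewrite leey.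
(* Equal infinite limits would give [ediff a b = +oo], against the finite bound; so [b - a] is a
   well-defined sum, and subtraction is continuous there. *)
move=> _ abh; have ba : b +? - a.
  by move: abh; rewrite ediffE; case: (a) (b) => [?||] [?||].
have lt_lim : - (h + e)%:E < b - a.
  by rewrite lteNl -ediffE (le_lt_trans abh)// lte_fin ltrDl.
have vu : \forall n \near \oo, - (h + e)%:E < v n - u n.
  have vuc : v n - u n @[n --> \oo] --> b - a by exact: cvgeB.
  exact: (vuc _ (open_ereal_gt' lt_lim)).
apply: filterS vu => n vun.
by rewrite ediffE leeNl -EFinD ltW.
Qed.

(** The product may be discontinuous when one factor vanishes and the other is [+oo], but then the
    left side is [0]; otherwise the products converge. *)
Lemma mule_le_limn_einf (R : realType) (u : nat -> \bar R) (x v : \bar R) :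
  u n @[n --> \oo] --> x -> (forall n, 0 <= u n) -> 0 <= x -> 0 <= v ->
  x * v <= limn_einf (fun n => u n * v).
Proof.
move=> ux u0 x0 v0.
have uv0 : 0 <= limn_einf (fun n => u n * v).
  rewrite -[leLHS](cvg_limn_einf_sup (cvg_cst 0)).1.
  by apply: le_limn_einf; apply: nearW => n; exact: mule_ge0.
have [v00|vn0] := eqVneq v 0; first by rewrite {1}v00 mule0.
have [->|xn0] := eqVneq x 0; first by rewrite mul0e.
rewrite (cvg_limn_einf_sup (cvgeM _ ux (cvg_cst v))).1//.
by rewrite mule_defE (negbTE vn0) (negbTE xn0).
Qed.

Lemma ge0_integral_mrestr d (T : measurableType d) (R : realType)
    (mu : {measure set T -> \bar R}) (D : set T) (mD : measurable D) (f : T -> \bar R) :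
  measurable_fun setT f -> (forall x, 0 <= f x) ->
  \int[mrestr mu mD]_x f x = \int[mu]_(x in D) f x.
Proof.
move=> mf f0.
have mDC : measurable (~` D) by exact: measurableC.
rewrite -(setUv D) ge0_integral_setU//; last 2 first.
- exact: measurable_funS mf.
- by apply/disj_setPS => x [].
rewrite [X in _ + X](_ : _ = 0) ?adde0; last first.
  apply: null_set_integral => //; last by rewrite /= /mrestr setICl measure0.
  exact: measurable_funS mf.
by apply: eq_measure_integral => A mA AD; rewrite /= /mrestr setIidl.
Qed.

(** * Restricted plans, majorants, and Fatou's lemma along a curve *)

Section subslope_stability.
Context {R : realType} {M : mmspacetime R} {d : M -> M -> R}.
Hypothesis d_inducing : dist_inducing d.

Lemma measurable_causal_speed (g : lcc M) : measurable_fun setT (causal_speed g).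
Proof. by rewrite /causal_speed; case: xgetP => [v _ []|_]. Qed.

Lemma causal_speed_ge0 (g : lcc M) t : 0 <= causal_speed g t.
Proof. by rewrite /causal_speed; case: xgetP => [v _ []|_]. Qed.

(** Restriction to [D] only decreases the marginals, and normalisation turns the bound [C] into
    [C / pi D]. *)
Lemma restricted_plan (pi : probability (borel_lcc d) R) (D : set (borel_lcc d)) :
  test_plan pi -> measurable D -> pi D != 0 ->
  exists2 pi' : probability (borel_lcc d) R, test_plan pi' &
    forall H : borel_lcc d -> \bar R, measurable_fun setT H -> (forall g, 0 <= H g) ->
      \int[pi]_(g in D) H g = pi D * \int[pi']_g H g.
Proof.
move=> [C C0 piC] mD D0.
have Dfin : pi D \is a fin_num by exact: fin_num_measure.
have r0 : (0 < fine (pi D))%R by rewrite fine_gt0// lt0e D0 measure_ge0/= ltey_eq Dfin.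
pose k : {nonneg R} := NngNum (ltW (divr_gt0 ltr01 r0)).
(* The last argument is the default of [mnormalize] for mass [0] or [+oo]; [D0] and [Dfin] exclude
   both. *)
pose pi' : probability (borel_lcc d) R := mnormalize (mrestr pi mD) pi.
have pi'E A : pi' A = mscale k (mrestr pi mD) A.
  rewrite /pi' /= /mnormalize /mscale /= /mrestr setTI (negbTE D0)/=.
  have -> : (pi D == +oo) = false by apply/negbTE; rewrite -ltey ltey_eq Dfin.
  by rewrite muleC div1r.
exists pi' => [|H mH H0].
  exists (C / fine (pi D))%R; first by rewrite divr_gt0.
  move=> t t0 t1 A mA; rewrite pi'E /mscale/= /mrestr div1r mulrC EFinM -muleA.
  apply: lee_wpmul2l; first by rewrite lee_fin invr_ge0 ltW.
  apply: le_trans (piC t t0 t1 A mA).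
  have mAt : measurable [set g : borel_lcc d | A ((g : lcc M) t)].
    by rewrite -[X in measurable X]setTI; exact: (measurable_eval d_inducing).
  by apply: le_measure => //; rewrite inE//; exact: measurableI.
rewrite [in RHS](eq_measure_integral (mscale k (mrestr pi mD))) => [|A _ _];
  last exact: pi'E.
rewrite ge0_integral_mscale// ge0_integral_mrestr// muleA.
by rewrite -[pi D]fineK// -EFinM /= div1r divff ?mul1e// gt_eqF.
Qed.

(** The subslope inequality for the plan normalised on [D] bounds an upper integral by a finite
    number, and [K] nearly attains the infimum defining it. Since [pi D <= 1], scaling back does not
    enlarge the error [e]. *)
Lemma subslope_majorant (f G : M -> \bar R) (pi : probability (borel_lcc d) R)
    (D : set (borel_lcc d)) (H : borel_lcc d -> \bar R) (e : R) :
  weak_subslope d f G -> test_plan pi -> measurable D ->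
  measurable_fun setT H -> (forall g, 0 <= H g) ->
  \int[pi]_(g in D) H g < +oo -> (0 < e)%R ->
  (forall g : lcc M, D g -> ediff (f (g 1%R)) (f (g 0%R)) <= H g) ->
  exists K : borel_lcc d -> \bar R,
    [/\ measurable_fun setT K, forall g, 0 <= K g,
        forall g : lcc M,
          \int[lebesgue_measure]_(t in `[0%R, 1%R]) (G (g t) * causal_speed g t) <= K g &
        \int[pi]_(g in D) K g <= \int[pi]_(g in D) H g + e%:E].
Proof.
move=> [_ _ fG] plan mD mH H0 Hoo e0 fH.
have [D0|D0] := eqVneq (pi D) 0.
  exists (cst +oo); split=> [//|g|g|]; [exact: leey|exact: leey|].
  rewrite (null_set_integral (f := cst +oo))//.
  by apply: adde_ge0; [exact: integral_ge0|rewrite lee_fin ltW].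
have [pi' plan' piE] := restricted_plan _ _ plan mD D0.
(* [H] bounds the difference on [D] only, whereas the upper integral asks for a majorant everywhere;
   the value outside [D] does not affect the integral for [pi']. *)
pose H' g := if g \in D then H g else +oo.
have H'0 g : 0 <= H' g by rewrite /H'; case: ifP.
have mH' : measurable_fun setT H'.
  apply: measurable_fun_ifT => //.
  by apply: (measurable_fun_bool true); rewrite setTI preimage_mem_true.
have H'E : \int[pi]_(g in D) H' g = \int[pi]_(g in D) H g.
  by apply: eq_integral => g gD; rewrite /H' gD.
have up_le : upper_integral pi' (fun g : lcc M =>
    \int[lebesgue_measure]_(t in `[0%R, 1%R]) (G (g t) * causal_speed g t)) <=
    \int[pi']_g H' g.
  apply: le_trans (fG pi' plan') _; apply: ereal_inf_lbound.
  exists H' => //; split=> // g.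
  rewrite /H'; case: ifPn => [/set_mem|_]; last exact: leey.
  exact: fH.
have piD0 : 0 < pi D by rewrite lt0e D0 measure_ge0.
have H'fin : \int[pi']_g H' g < +oo.
  rewrite ltey; apply/eqP => H'oo; move: Hoo.
  by rewrite -H'E piE// H'oo gt0_muley// ltxx.
have up_fin : upper_integral pi' (fun g : lcc M =>
    \int[lebesgue_measure]_(t in `[0%R, 1%R]) (G (g t) * causal_speed g t)) \is a fin_num.
  rewrite ge0_fin_numE ?(le_lt_trans up_le)//.
  by apply: le_ereal_inf_tmp => _ [K [_ K0 _] <-]; exact: integral_ge0.
have [_ [K [mK K0 GK] <-] Ke] := lb_ereal_inf_adherent e0 up_fin.
exists K; split=> //; rewrite -H'E !piE//.
apply: (@le_trans _ _ (pi D * (\int[pi']_g H' g + e%:E))).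
  by apply: lee_wpmul2l => //; rewrite (le_trans (ltW Ke))// leeD2r.
rewrite ge0_muleDr; [|exact: integral_ge0|by rewrite lee_fin ltW].
rewrite leeD2l//.
rewrite -[leRHS]mul1e; apply: lee_wpmul2r; first by rewrite lee_fin ltW.
exact: probability_le1.
Qed.

(** Fatou's lemma in time; [mule_le_limn_einf] compares the integrands at almost every [t], even
    where the speed is infinite. *)
Lemma subslope_integral_le_limn_einf (G_ : nat -> M -> \bar R) (G : M -> \bar R)
    (g : lcc M) :
  (forall n, measurable_fun setT (G_ n : borel M -> \bar R)) ->
  (forall n x, 0 <= G_ n x) ->
  measurable_fun setT (G : borel M -> \bar R) -> (forall x, 0 <= G x) ->
  {ae (@lebesgue_measure R), forall t, G_ n (g t) @[n --> \oo] --> G (g t)} ->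
  \int[lebesgue_measure]_(t in `[0%R, 1%R]) (G (g t) * causal_speed g t) <=
  limn_einf (fun n => \int[lebesgue_measure]_(t in `[0%R, 1%R])
                        (G_ n (g t) * causal_speed g t)).
Proof.
move=> mG_ G_0 mG G0 cvgG.
have mI (F : M -> \bar R) : measurable_fun setT (F : borel M -> \bar R) ->
    measurable_fun (`[0%R, 1%R]%classic : set R)
      (fun t : measurableTypeR R => F (g t) * causal_speed g t).
  move=> mF; apply: (measurable_funS measurableT) => //.
  apply: emeasurable_funM; last exact: measurable_causal_speed.
  exact: (measurableT_comp mF (measurable_curve d_inducing g)).
have I0 (F : M -> \bar R) : (forall x, 0 <= F x) ->
    forall t, 0 <= F (g t) * causal_speed g t.
  by move=> F0 t; rewrite mule_ge0// causal_speed_ge0.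
apply: (@le_trans _ _ (\int[lebesgue_measure]_(t in `[0%R, 1%R])
    limn_einf (fun n => G_ n (g t) * causal_speed g t))); last first.
  apply: fatou => // [n|n t _]; first exact: mI.
  exact: I0.
apply: ae_ge0_le_integral => //.
- by move=> t _; exact: I0.
- exact: mI.
- move=> t _; rewrite -[leLHS](cvg_limn_einf_sup (cvg_cst 0)).1.
  by apply: le_limn_einf; apply: nearW => n; exact: I0.
- by apply: (@measurable_fun_limn_einf _ R R _ (fun n t => G_ n (g t) * causal_speed g t))
    => n; exact: mI.
- apply: negligibleS cvgG => t /= nGt Gt; apply: nGt => _.
  by apply: mule_le_limn_einf => //; exact: causal_speed_ge0.
Qed.

End subslope_stability.

(** * Stability of weak subslopes *)

(** The maximum of [F] and [L] dominates [F] everywhere and equals [L] almost everywhere, so its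
    upper integral is the integral of [L]. *)
Lemma upper_integral_ae_le d (T : measurableType d) (R : realType)
    (mu : {measure set T -> \bar R}) (F L : T -> \bar R) :
  measurable_fun setT L -> (forall x, 0 <= L x) ->
  {ae mu, forall x, F x <= L x} -> upper_integral mu F <= \int[mu]_x L x.
Proof.
move=> mL L0 FL.
rewrite -(@upper_integralE _ _ _ mu (fun x => maxe (F x) (L x)) L)//.
  apply: le_ereal_inf_tmp => _ [H [mH H0 FLH] <-]; apply: ereal_inf_lbound.
  by exists H => //; split=> // x; apply: le_trans (FLH x); rewrite le_max lexx.
apply: negligibleS FL => x /= nFL FLx; apply: nFL; exact: max_r.
Qed.

Theorem proposition3p12 (R : realType) (M : mmspacetime R)
    (d : M -> M -> R) (d_inducing : dist_inducing d) (d_bounded : bounded_dist d)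
    (f_ : nat -> M -> \bar R) (f : M -> \bar R)
    (G_ : nat -> M -> \bar R) (G : M -> \bar R) :
  (forall n, causal_function (f_ n)) ->
  causal_function f ->
  {ae refmeas M, forall x, f_ n x @[n --> \oo] --> f x} ->
  (forall n, weak_subslope d (f_ n) (G_ n)) ->
  measurable_fun setT (G : borel M -> \bar R) ->
  (forall x, 0 <= G x) ->
  {ae refmeas M, forall x, G_ n x @[n --> \oo] --> G x} ->
  weak_subslope d f G.
Proof.
move=> f_causal f_causal' f_cvg G_subslope mG G0 G_cvg; split=> // pi plan.
apply: le_ereal_inf_tmp => _ [H [mH H0 fH] <-].
have [->|Hoo] := eqVneq (\int[pi]_g H g) +oo; first exact: leey.
(* One half of [e] is the slack in the definition of [D n], the other the error of the majorant
   [K n]. *)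
apply/lee_addgt0Pr => e e0; have e20 : (0 < e / 2)%R by rewrite divr_gt0.
have /choice[f' f'P] : forall n, exists f'n : M -> \bar R,
    measurable_fun setT (f'n : borel M -> \bar R) /\
    {ae refmeas M, forall x, f'n x = f_ n x}.
  move=> n; have [f'n mf'n f'nE] :=
    completed_measurable_modification _ _ _ _ _ (f_causal n).1.
  by exists f'n.
have aeM : Filter (nbhs (almost_everywhere (refmeas M))).
  exact: ae_filter_ringOfSetsType.
(* A single Borel null set gathers all the exceptional points, for every [n] at once. *)
have [N [mN N0 goodN]] : {ae refmeas M, forall x, [/\ forall n, f' n x = f_ n x,
    f_ n x @[n --> \oo] --> f x & G_ n x @[n --> \oo] --> G x]}.
  have f'_ae : {ae refmeas M, forall x n, f' n x = f_ n x}.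
    by apply: ae_foralln => n; exact: (f'P n).2.
  apply: filterS3 f'_ae f_cvg G_cvg => x; by split.
have {}goodN x : ~ N x -> [/\ forall n, f' n x = f_ n x,
    f_ n x @[n --> \oo] --> f x & G_ n x @[n --> \oo] --> G x].
  by move=> Nx; apply: contrapT => bad; apply/Nx/goodN.
pose ev (t : R) (g : borel_lcc d) : borel M := (g : lcc M) t.
have mev t : measurable_fun setT (ev t) by exact: measurable_eval.
have mevN t : measurable [set g | N (ev t g)].
  by rewrite -[X in measurable X]setTI; exact: mev.
pose Delta n (g : borel_lcc d) := ediff (f' n (ev 1%R g)) (f' n (ev 0%R g)).
pose He g := H g + (e / 2)%:E.
have mDelta n : measurable_fun setT (Delta n).
  rewrite (_ : Delta n = fun g => - (f' n (ev 0%R g) - f' n (ev 1%R g))); last first.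
    by apply/funext => g; exact: ediffE.
  apply: measurableT_comp => //.
  by apply: emeasurable_funB; apply: measurableT_comp (mev _); exact: (f'P n).1.
have mHe : measurable_fun setT He by exact: emeasurable_funD.
have He0 g : 0 <= He g by rewrite adde_ge0// lee_fin ltW.
(* Curves with an endpoint in [N] are removed, so that on [D n] the Borel versions [f' n] give the
   true increments of [f_ n]. *)
pose D n := [set g | Delta n g <= He g] `\`
  ([set g | N (ev 0%R g)] `|` [set g | N (ev 1%R g)]).
have mD n : measurable (D n).
  apply: measurableD; last exact: measurableU.
  by rewrite -[X in measurable X]setTI; exact: measurable_lee.
have intHe n : \int[pi]_(g in D n) He g <= \int[pi]_g H g + (e / 2)%:E.
  apply: (@le_trans _ _ (\int[pi]_g He g)); first exact: ge0_subset_integral.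
  rewrite /He ge0_integralD//; last by move=> g _; rewrite lee_fin ltW.
  rewrite (integral_cst pi measurableT (e / 2)%:E) leeD2l//.
  rewrite -[leRHS]mule1; apply: lee_wpmul2l; first by rewrite lee_fin ltW.
  exact: probability_le1.
have /choice[K KP] : forall n, exists K : borel_lcc d -> \bar R,
    [/\ measurable_fun setT K, forall g, 0 <= K g,
        forall g : lcc M, \int[lebesgue_measure]_(t in `[0%R, 1%R])
          (G_ n (g t) * causal_speed g t) <= K g &
        \int[pi]_(g in D n) K g <= \int[pi]_(g in D n) He g + (e / 2)%:E].
  move=> n; apply: (subslope_majorant d_inducing _ _ _ _ _ _ (G_subslope n)) => //.
    by rewrite (le_lt_trans (intHe n))// lte_add_pinfty ?ltry// ltey.
  move=> g [/= Dg /not_orP[g0 g1]].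
  have [f'0 _ _] := goodN _ g0; have [f'1 _ _] := goodN _ g1.
  by rewrite -f'0 -f'1.
have Kr0 n g : 0 <= ((K n) \_ (D n)) g.
  by rewrite patchE; case: ifP => // _; have [_ ->] := KP n.
have mKr n : measurable_fun setT ((K n) \_ (D n)).
  apply/(measurable_restrictT _ (mD n)).
  by apply: measurable_funTS; have [] := KP n.
(* Setting [K n] to [0] off [D n] leaves the lower limit unchanged at curves that are eventually in
   [D n], which is almost every curve. *)
pose L g := limn_einf (fun n => ((K n) \_ (D n)) g).
have mL : measurable_fun setT L by exact: measurable_fun_limn_einf.
have L0 g : 0 <= L g.
  rewrite -[leLHS](cvg_limn_einf_sup (cvg_cst 0)).1.
  by apply: le_limn_einf; exact: nearW.
apply: (@le_trans _ _ (\int[pi]_g L g)); last first.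
  apply: (le_trans (fatou _ _ _ _)) => //.
  apply: limn_einf_le_cst => n; rewrite -integral_mkcond.
  have [_ _ _ /le_trans] := KP n; apply.
  by rewrite [e in leRHS]splitr EFinD addeA leeD2r.
apply: upper_integral_ae_le => //.
have aeN t : {ae pi, forall g : borel_lcc d, ~ N ((g : lcc M) t)}.
  exists [set g | N (ev t g)]; split => [//||g /=]; last by rewrite notK.
  exact: test_plan_null.
have aepi : Filter (nbhs (almost_everywhere pi)) by exact: ae_filter_ringOfSetsType.
have := test_plan_ae_null d_inducing _ _ plan mN N0.
apply: filterS3 (aeN 0%R) (aeN 1%R) => g g0 g1 gN.
apply: (@le_trans _ _ (limn_einf (fun n => \int[lebesgue_measure]_(t in `[0%R, 1%R])
    (G_ n ((g : lcc M) t) * causal_speed g t)))).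
  apply: (subslope_integral_le_limn_einf d_inducing) => //.
  - by move=> n; have [] := G_subslope n.
  - by move=> n; have [] := G_subslope n.
  - by apply: negligibleS gN => t /= nG gt; apply: nG; have [] := goodN _ gt.
apply: le_limn_einf.
have [f'0 f0 _] := goodN _ g0; have [f'1 f1 _] := goodN _ g1.
(* Convergence at both endpoints, with slack [e / 2], puts [g] in [D n] for all large [n]. *)
have := near_ediff_le _ _ _ _ _ _ _ f1 f0 e20 (H0 g) (fH g); apply: filterS => n Dn.
rewrite patchE ifT; first by have [_ _ ->] := KP n.
by apply/mem_set; split; [rewrite /= /Delta f'0 f'1|case].
Qed.
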